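(* Let $I\subseteq[0,n-1]$ and $V=\mathrm{Val}^B([0,n-1]\setminus I)$. Let $Cl_V$ be the subalgebra of $Cl_n$ generated by $\{c_v:v\in V\}$. For $c\in Cl_n$ define $f_c\colon\mathcal M_I\to\mathcal M_I$ by $f_c(x\varepsilon_I)=xc\,\varepsilon_I$ for all $x\in Cl_n$. Setting $(x\varepsilon_I)\cdot c=f_c(x\varepsilon_I)$ (extended linearly) gives a right action of $Cl_V$ on $\mathcal M_I$ that commutes with the left action of $HCl_n^B(0)$, and the map $c\mapsto f_c$ is an isomorphism from $Cl_V$ to $\mathrm{End}_{HCl_n^B(0)}(\mathcal M_I)$.
   Context: $H_n^B(0)$ is the $\mathbb C$-algebra generated by $\pi_0,\dots,\pi_{n-1}$ with $\pi_i^2=-\pi_i$, $\pi_i\pi_j=\pi_j\pi_i$ for $|i-j|\ge2$, $\pi_i\pi_{i+1}\pi_i=\pi_{i+1}\pi_i\pi_{i+1}$ ($1\le i\le n-2$), $\pi_0\pi_1\pi_0\pi_1=\pi_1\pi_0\pi_1\pi_0$. $Cl_n$ is generated by $c_1,\dots,c_n$ with $c_j^2=-1$, $c_ic_j=-c_jc_i$ ($i\neq j$). $HCl_n^B(0)$ is generated by $H_n^B(0)$ and $Cl_n$ subject additionally to: $\pi_ic_j=c_j\pi_i$ for $j\ne i,i+1$; $\pi_ic_{i+1}=c_i\pi_i$ and $(\pi_i+1)c_i=c_{i+1}(\pi_i+1)$ for $1\le i\le n-1$; $\pi_0c_1=\sqrt{-1}\,\pi_0$. $\mathcal S_I^B=\mathbb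 C\varepsilon_I$ is the $H_n^B(0)$-module with $\pi_j\varepsilon_I=-\varepsilon_I$ if $j\in I$ and $0$ otherwise; $\mathcal M_I=\mathrm{Ind}_{H_n^B(0)}^{HCl_n^B(0)}(\mathcal S_I^B)$, which is free as a $Cl_n$-module on $\varepsilon_I$. For $J\subseteq[0,n-1]$, $\mathrm{Val}^B(J)=\{v\in[n]:v\notin J,\ v-1\in J\}$.
   Formalization: Freeness of M_I over Cl_n on ε_I is a hypothesis: for n ≥ 2 and 0 ∈ I the given relations force π_0 = 0, so M_I = 0 and the claim fails. The isomorphism is for endomorphisms composed left to right, as f_{cd} = f_d∘f_c. *)

(* Defs.v *)
From HB Require Import structures.
From mathcomp Require Import all_boot all_order all_algebra.
From mathcomp Require Import boolp reals complex.
From mathcomp Require Import freeg monalg.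

Set Implicit Arguments.
Unset Strict Implicit.
Unset Printing Implicit Defensive.

Import GRing.Theory.

Local Open Scope ring_scope.
Local Open Scope quotient_scope.

(* Unital associative algebras presented by generators and relations.         *)

Section FreeAlgebra.
Variables (K : comNzRingType) (X : choiceType).

Definition freeAlg := {malg K[{fmonom X}]}.
HB.instance Definition _ := GRing.Lalgebra.copy freeAlg {malg K[{fmonom X}]}.

Definition fgen : X -> freeAlg := locked (fun x => mkmalgU (fmu x) 1).

Lemma freeAlg_scalerAr (k : K) (x y : freeAlg) : k *: (x * y) = x * (k *: y).
Proof.
have central (z : freeAlg) : k%:MP * z = z * k%:MP :> {malg K[{fmonom X}]}.
  rewrite [z]monalgE mulr_sumr mulr_suml; apply: eq_bigr => m _.
  by rewrite /malgC !malgM_def !fgmulUU mul1m mulm1 mulrC.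
by rewrite -[LHS]mul_malgC -[k *: y]mul_malgC mulrA central -mulrA.
Qed.
HB.instance Definition _ :=
  GRing.Lalgebra_isAlgebra.Build K freeAlg freeAlg_scalerAr.

Section Lift.
Variables (B : algType K) (g : X -> B).

Definition fmonom_eval (m : {fmonom X}) : B := \prod_(x <- (m : seq X)) g x.

Lemma fmonom_eval_morph : mmorphism fmonom_eval.
Proof.
split=> [m1 m2|]; first by rewrite /fmonom_eval fmM big_cat.
by rewrite /fmonom_eval fm1 big_nil.
Qed.
HB.instance Definition _ :=
  monalg.isMultiplicative.Build _ B fmonom_eval fmonom_eval_morph.

Definition free_lift (a : freeAlg) : B := mmap (in_alg B) fmonom_eval a.

Lemma free_lift_is_zmod_morphism : zmod_morphism free_lift.
Proof. by move=> x y; apply: mmapB. Qed.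
Lemma free_lift_is_monoid_morphism : monoid_morphism free_lift.
Proof.
have [|M U] := @commr_mmap_is_multiplicative _ _ _ (in_alg B) fmonom_eval.
  by move=> z m m'; rewrite /GRing.comm /= mulr_algl mulr_algr.
by split.
Qed.
HB.instance Definition _ :=
  GRing.isZmodMorphism.Build freeAlg B free_lift free_lift_is_zmod_morphism.
HB.instance Definition _ :=
  GRing.isMonoidMorphism.Build freeAlg B free_lift free_lift_is_monoid_morphism.

Lemma free_liftE x : free_lift (fgen x) = g x.
Proof.
by unlock fgen; rewrite /free_lift mmapU /= scale1r mul1r /fmonom_eval fmU big_seq1.
Qed.

Lemma free_liftM a b : free_lift (a * b) = free_lift a * free_lift b.
Proof. exact: rmorphM. Qed.
Lemma free_liftD a b : free_lift (a + b) = free_lift a + free_lift b.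
Proof. exact: raddfD. Qed.
Lemma free_liftN a : free_lift (- a) = - free_lift a.
Proof. exact: raddfN. Qed.
Lemma free_lift1 : free_lift 1 = 1.
Proof. exact: rmorph1. Qed.
Lemma free_liftZ k a : free_lift (k *: a) = k *: free_lift a.
Proof. by rewrite /free_lift mmapZ /= mulr_algl. Qed.

End Lift.
End FreeAlgebra.

Section PresentedAlgebra.
Variables (K : comNzRingType) (X : choiceType).
Variable rel : freeAlg K X -> freeAlg K X -> Prop.

(* The two-sided ideal generated by the differences a - b, rel a b.           *)
Inductive rel_ideal : freeAlg K X -> Prop :=
| rel_ideal_gen a b : rel a b -> rel_ideal (a - b)
| rel_ideal0 : rel_ideal 0
| rel_idealD x y : rel_ideal x -> rel_ideal y -> rel_ideal (x + y)
| rel_idealMl a x : rel_ideal x -> rel_ideal (a * x)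
| rel_idealMr a x : rel_ideal x -> rel_ideal (x * a).

Definition in_rel_ideal : {pred freeAlg K X} := fun x => `[< rel_ideal x >].

Lemma rel_ideal_zmod : zmod_closed in_rel_ideal.
Proof.
split=> [|x y]; rewrite !unfold_in; first exact/asboolT/rel_ideal0.
move=> /asboolP x_in /asboolP y_in; apply/asboolT/rel_idealD => //.
by rewrite -mulN1r; apply: rel_idealMl.
Qed.
HB.instance Definition _ :=
  GRing.isZmodClosed.Build (freeAlg K X) in_rel_ideal rel_ideal_zmod.

Definition presAlg := Quotient.quot in_rel_ideal.
HB.instance Definition _ := GRing.Zmodule.on presAlg.

Definition pres_pi : freeAlg K X -> presAlg :=
  locked (fun a => \pi_(Quotient.quot in_rel_ideal) a).
Definition pres_repr : presAlg -> freeAlg K X :=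
  locked (fun q => repr (q : Quotient.quot in_rel_ideal)).

Lemma pres_reprK : cancel pres_repr pres_pi.
Proof. by move=> q; unlock pres_pi pres_repr; apply: reprK. Qed.

Lemma pres_piP a b : pres_pi a = pres_pi b <-> rel_ideal (a - b).
Proof.
unlock pres_pi; split=> [/eqP|ab].
  by rewrite -Quotient.idealrBE unfold_in => /asboolP.
by apply/eqP; rewrite -Quotient.idealrBE; apply/asboolP.
Qed.

Lemma pres_pi_is_zmod_morphism : zmod_morphism pres_pi.
Proof. by move=> a b; unlock pres_pi; apply: raddfB. Qed.
HB.instance Definition _ :=
  GRing.isZmodMorphism.Build _ _ pres_pi pres_pi_is_zmod_morphism.

Definition pres_one : presAlg := pres_pi 1.
Definition pres_mul : presAlg -> presAlg -> presAlg :=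
  locked (fun p q => pres_pi (pres_repr p * pres_repr q)).

Lemma pres_piM a b : pres_mul (pres_pi a) (pres_pi b) = pres_pi (a * b).
Proof.
unlock pres_mul; apply/pres_piP; set a' := pres_repr _; set b' := pres_repr _.
have aa' : rel_ideal (a' - a) by apply/pres_piP; rewrite pres_reprK.
have bb' : rel_ideal (b' - b) by apply/pres_piP; rewrite pres_reprK.
have -> : a' * b' - a * b = a' * (b' - b) + (a' - a) * b.
  by rewrite mulrBr mulrBl addrA addrNK.
by apply: rel_idealD; [apply: rel_idealMl|apply: rel_idealMr].
Qed.

Lemma pres_mulA : associative pres_mul.
Proof.
move=> p q r; rewrite -[p]pres_reprK -[q]pres_reprK -[r]pres_reprK.
by rewrite !pres_piM mulrA.
Qed.
Lemma pres_mul1 : left_id pres_one pres_mul.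
Proof. by move=> p; rewrite -[p]pres_reprK pres_piM mul1r. Qed.
Lemma pres_mulr1 : right_id pres_one pres_mul.
Proof. by move=> p; rewrite -[p]pres_reprK pres_piM mulr1. Qed.
Lemma pres_mulDl : left_distributive pres_mul +%R.
Proof.
move=> p q r; rewrite -[p]pres_reprK -[q]pres_reprK -[r]pres_reprK.
by rewrite -raddfD !pres_piM -raddfD mulrDl.
Qed.
Lemma pres_mulDr : right_distributive pres_mul +%R.
Proof.
move=> p q r; rewrite -[p]pres_reprK -[q]pres_reprK -[r]pres_reprK.
by rewrite -raddfD !pres_piM -raddfD mulrDr.
Qed.

(* Only a pzRingType: for arbitrary relations the quotient may be trivial.    *)
HB.instance Definition _ := GRing.Zmodule_isPzRing.Build presAlg
  pres_mulA pres_mul1 pres_mulr1 pres_mulDl pres_mulDr.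

Lemma pres_pi_is_monoid_morphism : monoid_morphism pres_pi.
Proof. by split=> [|a b]; [|apply/esym/pres_piM]. Qed.
HB.instance Definition _ :=
  GRing.isMonoidMorphism.Build _ _ pres_pi pres_pi_is_monoid_morphism.

Lemma pres_piMr a b : pres_pi (a * b) = pres_pi a * pres_pi b.
Proof. exact/esym/pres_piM. Qed.

Lemma pres_piD a b : pres_pi (a + b) = pres_pi a + pres_pi b.
Proof. exact: raddfD. Qed.
Lemma pres_piN a : pres_pi (- a) = - pres_pi a.
Proof. exact: raddfN. Qed.
Lemma pres_pi1 : pres_pi 1 = 1.
Proof. by []. Qed.

Definition pres_scale : K -> presAlg -> presAlg :=
  locked (fun k q => pres_pi k%:A * q).

Lemma pres_scaleE k q : pres_scale k q = pres_pi k%:A * q.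
Proof. by unlock pres_scale. Qed.

Lemma pres_scaleA k l q : pres_scale k (pres_scale l q) = pres_scale (k * l) q.
Proof.
rewrite pres_scaleE pres_scaleE [RHS]pres_scaleE [LHS]mulrA; congr (_ * _).
by rewrite -pres_piMr; congr (pres_pi _); rewrite mulr_algl scalerA.
Qed.
Lemma pres_scale1 : left_id 1 pres_scale.
Proof. by move=> q; rewrite !pres_scaleE scale1r rmorph1 mul1r. Qed.
Lemma pres_scaleDr : right_distributive pres_scale +%R.
Proof. by move=> k p q; rewrite !pres_scaleE mulrDr. Qed.
Lemma pres_scaleDl q : {morph pres_scale^~ q : k l / k + l}.
Proof. by move=> k l; rewrite !pres_scaleE scalerDl raddfD mulrDl. Qed.
HB.instance Definition _ := GRing.Zmodule_isLmodule.Build K presAlg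
  pres_scaleA pres_scale1 pres_scaleDr pres_scaleDl.

Lemma pres_piZ k a : pres_pi (k *: a) = k *: pres_pi a.
Proof.
by rewrite -[RHS]/(pres_scale _ _) pres_scaleE -pres_piMr mulr_algl.
Qed.
Lemma pres_scalerAl k (p q : presAlg) : k *: (p * q) = (k *: p) * q.
Proof. by rewrite -![_ *: _]/(pres_scale _ _) !pres_scaleE mulrA. Qed.
Lemma pres_scalerAr k (p q : presAlg) : k *: (p * q) = p * (k *: q).
Proof.
rewrite -[p]pres_reprK -[q]pres_reprK -pres_piMr -!pres_piZ -pres_piMr.
by rewrite scalerAr.
Qed.

Definition pgen (x : X) : presAlg := pres_pi (fgen K x).

Lemma pres_rel a b : rel a b -> pres_pi a = pres_pi b.
Proof. by move=> ab; apply/pres_piP/rel_ideal_gen. Qed.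

Section Lift.
Variables (B : pzRingType) (F : {rmorphism freeAlg K X -> B}).
Hypothesis F_rel : forall a b, rel a b -> F a = F b.

Definition pres_lift of (forall a b, rel a b -> F a = F b) :=
  fun q : presAlg => F (pres_repr q).

Local Notation L := (pres_lift F_rel).

Lemma pres_liftE a : L (pres_pi a) = F a.
Proof.
rewrite /pres_lift; apply/eqP; rewrite -subr_eq0 -rmorphB /=.
have : rel_ideal (pres_repr (pres_pi a) - a).
  by apply/pres_piP; rewrite pres_reprK.
elim=> [b c /F_rel bc||x y _ /eqP Fx _ /eqP Fy|b x _ /eqP Fx|b x _ /eqP Fx].
- by rewrite rmorphB bc subrr.
- by rewrite rmorph0.
- by rewrite rmorphD Fx Fy addr0.
- by rewrite rmorphM Fx mulr0.
- by rewrite rmorphM Fx mul0r.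
Qed.

Lemma pres_lift_is_zmod_morphism : zmod_morphism L.
Proof.
move=> p q; rewrite -[p]pres_reprK -[q]pres_reprK -raddfB !pres_liftE.
exact: raddfB.
Qed.
Lemma pres_lift_is_monoid_morphism : monoid_morphism L.
Proof.
split=> [|p q]; first by rewrite -(rmorph1 F) -pres_liftE rmorph1.
rewrite -[p]pres_reprK -[q]pres_reprK -rmorphM !pres_liftE.
exact: rmorphM.
Qed.
HB.instance Definition _ :=
  GRing.isZmodMorphism.Build presAlg B L pres_lift_is_zmod_morphism.
HB.instance Definition _ :=
  GRing.isMonoidMorphism.Build presAlg B L pres_lift_is_monoid_morphism.

End Lift.
End PresentedAlgebra.

(* A (x)_B S for a ring morphism phi : B -> A and a left B-module S: the free *)
(* abelian group on A * S modulo biadditivity and (a phi(b), s) ~ (a, b s).   *)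
Section Tensor.
Variables (B A : pzRingType) (phi : {rmorphism B -> A}) (S : lmodType B).

Local Notation F := {freeg (A * S) / int}.
Definition ftens (a : A) (s : S) : F := Freeg [:: (1, (a, s))].

Inductive tens_rel : F -> Prop :=
| tens_relDl a a' s : tens_rel (ftens (a + a') s - ftens a s - ftens a' s)
| tens_relDr a s s' : tens_rel (ftens a (s + s') - ftens a s - ftens a s')
| tens_relM a b s : tens_rel (ftens (a * phi b) s - ftens a (b *: s))
| tens_rel0 : tens_rel 0
| tens_relB x y : tens_rel x -> tens_rel y -> tens_rel (x - y).

Definition in_tens_rel : {pred F} := fun x => `[< tens_rel x >].

Lemma tens_rel_zmod : zmod_closed in_tens_rel.
Proof.
split=> [|x y]; rewrite !unfold_in; first exact/asboolT/tens_rel0.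
by move=> /asboolP x_in /asboolP y_in; apply/asboolT/tens_relB.
Qed.
HB.instance Definition _ := GRing.isZmodClosed.Build F in_tens_rel tens_rel_zmod.

Definition tensor := Quotient.quot in_tens_rel.
HB.instance Definition _ := GRing.Zmodule.on tensor.

Definition tens_pi : F -> tensor :=
  locked (fun x => \pi_(Quotient.quot in_tens_rel) x).
Definition tens_repr : tensor -> F :=
  locked (fun q => repr (q : Quotient.quot in_tens_rel)).
Definition tens (a : A) (s : S) : tensor := tens_pi (ftens a s).

Lemma tens_reprK : cancel tens_repr tens_pi.
Proof. by move=> q; unlock tens_pi tens_repr; apply: reprK. Qed.

Lemma tens_piP x y : tens_pi x = tens_pi y <-> tens_rel (x - y).
Proof.
unlock tens_pi; split=> [/eqP|xy].
  by rewrite -Quotient.idealrBE unfold_in => /asboolP.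
by apply/eqP; rewrite -Quotient.idealrBE; apply/asboolP.
Qed.

Lemma tens_pi_is_zmod_morphism : zmod_morphism tens_pi.
Proof. by move=> x y; unlock tens_pi; apply: raddfB. Qed.
HB.instance Definition _ :=
  GRing.isZmodMorphism.Build _ _ tens_pi tens_pi_is_zmod_morphism.

Lemma tensDl a a' s : tens (a + a') s = tens a s + tens a' s.
Proof.
rewrite -raddfD; apply/tens_piP; rewrite opprD addrA; exact: tens_relDl.
Qed.
Lemma tensDr a s s' : tens a (s + s') = tens a s + tens a s'.
Proof.
rewrite -raddfD; apply/tens_piP; rewrite opprD addrA; exact: tens_relDr.
Qed.
Lemma tensM a b s : tens (a * phi b) s = tens a (b *: s).
Proof. exact/tens_piP/tens_relM. Qed.

Definition ftens_act (a : A) : F -> F :=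
  fglift (fun p : A * S => ftens (a * p.1) p.2).

Lemma ftens_act_is_zmod_morphism a : zmod_morphism (ftens_act a).
Proof. exact: lift_is_additive. Qed.
HB.instance Definition _ a :=
  GRing.isZmodMorphism.Build F F (ftens_act a) (ftens_act_is_zmod_morphism a).

Lemma ftens_actE a b s : ftens_act a (ftens b s) = ftens (a * b) s.
Proof. by rewrite /ftens_act liftU scale1r. Qed.

Lemma tens_rel_act a x : tens_rel x -> tens_rel (ftens_act a x).
Proof.
elim=> [b b' s|b s s'|b c s||y z _ Hy _ Hz].
- by rewrite !raddfB /= !ftens_actE mulrDr; apply: tens_relDl.
- by rewrite !raddfB /= !ftens_actE; apply: tens_relDr.
- by rewrite raddfB /= !ftens_actE mulrA; apply: tens_relM.
- by rewrite raddf0; apply: tens_rel0.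
- by rewrite raddfB; apply: tens_relB.
Qed.

Definition tens_act : A -> tensor -> tensor :=
  locked (fun a q => tens_pi (ftens_act a (tens_repr q))).

Lemma tens_act_pi a x : tens_act a (tens_pi x) = tens_pi (ftens_act a x).
Proof.
unlock tens_act; apply/tens_piP; rewrite -raddfB; apply: tens_rel_act.
by apply/tens_piP; rewrite tens_reprK.
Qed.

Lemma tens_actE a b s : tens_act a (tens b s) = tens (a * b) s.
Proof. by rewrite tens_act_pi ftens_actE. Qed.

Lemma tens_act_is_zmod_morphism a : zmod_morphism (tens_act a).
Proof.
move=> p q; rewrite -[p]tens_reprK -[q]tens_reprK -raddfB !tens_act_pi.
by rewrite !raddfB.
Qed.
HB.instance Definition _ a := GRing.isZmodMorphism.Build tensor tensor
  (tens_act a) (tens_act_is_zmod_morphism a).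

Lemma tens_ind (P : tensor -> Prop) : P 0 ->
  (forall a s q, P q -> P (tens a s + q)) ->
  (forall a s q, P q -> P (- tens a s + q)) -> forall q, P q.
Proof.
move=> P0 PD PB q; rewrite -[q]tens_reprK -[tens_repr q]Freeg_enum.
elim: (fgenum _) => [|[k [a s]] r IHr]; first by rewrite freeg_nil raddf0.
rewrite -cat1s freeg_cat raddfD /=.
have -> : [freeg [:: (k, (a, s))]] = ftens a s *~ k.
  by rewrite /ftens freegU_mulz intz.
elim: k => [|k IHk|k IHk]; first by rewrite mulr0z raddf0 add0r.
- by rewrite intS mulrzDr mulr1z raddfD -addrA; apply: PD.
- by rewrite intS opprD mulrzDr mulrN1z raddfD raddfN -addrA; apply: PB.
Qed.

Lemma tens_actA a b q : tens_act a (tens_act b q) = tens_act (a * b) q.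
Proof.
elim/tens_ind: q => [|c s q IH|c s q IH].
- by rewrite !raddf0.
- by rewrite !raddfD /= IH !tens_actE mulrA.
- by rewrite !raddfD !raddfN /= IH !tens_actE mulrA.
Qed.
Lemma tens_act1 : left_id 1 tens_act.
Proof.
elim/tens_ind => [|c s q IH|c s q IH].
- by rewrite raddf0.
- by rewrite raddfD /= IH tens_actE mul1r.
- by rewrite raddfD raddfN /= IH tens_actE mul1r.
Qed.
Lemma tens_actDr : right_distributive tens_act +%R.
Proof. by move=> a p q; rewrite raddfD. Qed.
Lemma tens_actDl q : {morph tens_act^~ q : a b / a + b}.
Proof.
move=> a b; elim/tens_ind: q => [|c s q IH|c s q IH].
- by rewrite !raddf0 addr0.
- by rewrite !raddfD /= IH !tens_actE mulrDl tensDl addrACA.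
- by rewrite !raddfD !raddfN /= IH !tens_actE mulrDl tensDl opprD addrACA.
Qed.
HB.instance Definition _ := GRing.Zmodule_isLmodule.Build A tensor
  tens_actA tens_act1 tens_actDr tens_actDl.

End Tensor.

(* The algebra End_A(M) of a left module M over a K-algebra A presented as    *)
(* above: the product is composition (f * g = f \o g), and K acts through     *)
(* k *: 1 : A, which is central.                                              *)
Section Endomorphisms.
Variables (K : comNzRingType) (X : choiceType).
Variable rel : freeAlg K X -> freeAlg K X -> Prop.
Local Notation A := (presAlg rel).
Variable M : lmodType A.

Definition kscale (k : K) (m : M) : M := (k *: (1 : A)) *: m.

Lemma kscale_comm k (a : A) m : kscale k (a *: m) = a *: kscale k m.
Proof.
rewrite /kscale [LHS]scalerA [RHS]scalerA; congr (_ *: _).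
by rewrite -[LHS]pres_scalerAl -[RHS]pres_scalerAr mul1r mulr1.
Qed.
Lemma kscaleA k l m : kscale k (kscale l m) = kscale (k * l) m.
Proof.
rewrite /kscale [LHS]scalerA; congr (_ *: _).
by rewrite -[LHS]pres_scalerAl mul1r [LHS]scalerA.
Qed.
Lemma kscale1 m : kscale 1 m = m.
Proof. by rewrite /kscale [X in X *: _]scale1r scale1r. Qed.
Lemma kscaleDr k m m' : kscale k (m + m') = kscale k m + kscale k m'.
Proof. exact: scalerDr. Qed.
Lemma kscaleDl k l m : kscale (k + l) m = kscale k m + kscale l m.
Proof. by rewrite /kscale [X in X *: _]scalerDl [LHS]scalerDl. Qed.

Definition endo := {linear M -> M}.
HB.instance Definition _ := gen_eqMixin endo.
HB.instance Definition _ := gen_choiceMixin endo.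

Definition endo_fun (f : endo) : M -> M := GRing.Linear.sort f.
Coercion endo_fun : endo >-> Funclass.

Lemma endoP (f g : endo) : endo_fun f =1 endo_fun g -> f = g.
Proof.
case: f g => [f [[fa] [fs]]] [g [[ga] [gs]]] /funext; rewrite /endo_fun /= => fg.
subst g.
by rewrite (Prop_irrelevance fa ga) (Prop_irrelevance fs gs).
Qed.

Lemma endoD (f : endo) m m' : f (m + m') = f m + f m'.
Proof. exact: linearD. Qed.
Lemma endoZ (f : endo) a m : f (a *: m) = a *: f m.
Proof. exact: linearZZ. Qed.

Definition endo_of (f : M -> M) (fL : linear f) : endo :=
  HB.pack f (GRing.isLinear.Build A M M *:%R f fL).

Lemma endo_ofE f (fL : linear f) m : endo_of fL m = f m :> M.
Proof. by []. Qed.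

Lemma endo0_linear : linear (fun _ : M => 0 : M).
Proof. by move=> a m m'; rewrite scaler0 addr0. Qed.
Lemma endo1_linear : linear (fun m : M => m).
Proof. by []. Qed.
Lemma endo_add_linear (f g : endo) : linear (fun m => f m + g m).
Proof. by move=> a m m'; rewrite !endoD !endoZ scalerDr addrACA. Qed.
Lemma endo_opp_linear (f : endo) : linear (fun m => - f m).
Proof. by move=> a m m'; rewrite endoD endoZ opprD scalerN. Qed.
Lemma endo_mul_linear (f g : endo) : linear (fun m => f (g m)).
Proof. by move=> a m m'; rewrite !(endoD, endoZ). Qed.
Lemma endo_scale_linear k (f : endo) : linear (fun m => kscale k (f m)).
Proof. by move=> a m m'; rewrite endoD endoZ kscaleDr kscale_comm. Qed.

Definition endo0 := endo_of endo0_linear.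
Definition endo1 := endo_of endo1_linear.
Definition endo_add f g := endo_of (endo_add_linear f g).
Definition endo_opp f := endo_of (endo_opp_linear f).
Definition endo_mul f g := endo_of (endo_mul_linear f g).
Definition endo_scale k f := endo_of (endo_scale_linear k f).

Lemma endo_addA : associative endo_add.
Proof. by move=> f g h; apply: endoP => m; apply: addrA. Qed.
Lemma endo_addC : commutative endo_add.
Proof. by move=> f g; apply: endoP => m; apply: addrC. Qed.
Lemma endo_add0 : left_id endo0 endo_add.
Proof. by move=> f; apply: endoP => m; apply: add0r. Qed.
Lemma endo_addN : left_inverse endo0 endo_opp endo_add.
Proof. by move=> f; apply: endoP => m; apply: addNr. Qed.
HB.instance Definition _ :=
  GRing.isZmodule.Build endo endo_addA endo_addC endo_add0 endo_addN.

Lemma endo_mulA : associative endo_mul.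
Proof. by move=> f g h; apply: endoP. Qed.
Lemma endo_mul1 : left_id endo1 endo_mul.
Proof. by move=> f; apply: endoP. Qed.
Lemma endo_mulr1 : right_id endo1 endo_mul.
Proof. by move=> f; apply: endoP. Qed.
Lemma endo_mulDl : left_distributive endo_mul +%R.
Proof. by move=> f g h; apply: endoP. Qed.
Lemma endo_mulDr : right_distributive endo_mul +%R.
Proof. by move=> f g h; apply: endoP => m; apply: endoD. Qed.
HB.instance Definition _ := GRing.Zmodule_isPzRing.Build endo
  endo_mulA endo_mul1 endo_mulr1 endo_mulDl endo_mulDr.

Lemma endo_scaleA k l f : endo_scale k (endo_scale l f) = endo_scale (k * l) f.
Proof. by apply: endoP => m; apply: kscaleA. Qed.
Lemma endo_scale1 : left_id 1 endo_scale.
Proof. by move=> f; apply: endoP => m; apply: kscale1. Qed.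
Lemma endo_scaleDr : right_distributive endo_scale +%R.
Proof. by move=> k f g; apply: endoP => m; apply: kscaleDr. Qed.
Lemma endo_scaleDl f : {morph endo_scale^~ f : k l / k + l}.
Proof. by move=> k l; apply: endoP => m; apply: kscaleDl. Qed.
HB.instance Definition _ := GRing.Zmodule_isLmodule.Build K endo
  endo_scaleA endo_scale1 endo_scaleDr endo_scaleDl.

End Endomorphisms.

(* Index conventions: i : 'I_n stands for pi_i, and j : 'I_n stands for       *)
(* c_(j+1) and for the element j+1 of [n] = {1, ..., n} (see lbl).            *)
Section HeckeClifford.
Variables (R : realType) (n : nat).
Local Notation C := R[i].

Section Relations.
Variables (A : pzRingType) (p c : 'I_n -> A).

Inductive rel_H : A -> A -> Prop :=
| rel_H_sq i : rel_H (p i * p i) (- p i)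
| rel_H_comm (i j : 'I_n) : (i.+2 <= j)%N || (j.+2 <= i)%N ->
    rel_H (p i * p j) (p j * p i)
| rel_H_braid (i j : 'I_n) : (1 <= i)%N -> j = i.+1 :> nat ->
    rel_H (p i * p j * p i) (p j * p i * p j)
| rel_H_braid0 (i j : 'I_n) : i = 0%N :> nat -> j = 1%N :> nat ->
    rel_H (p i * p j * p i * p j) (p j * p i * p j * p i).

Inductive rel_Cl : A -> A -> Prop :=
| rel_Cl_sq j : rel_Cl (c j * c j) (- 1)
| rel_Cl_anti i j : i != j -> rel_Cl (c i * c j) (- (c j * c i)).

End Relations.

Lemma rel_H_morph (A B : pzRingType) (phi : {rmorphism A -> B})
    (p : 'I_n -> A) (q : 'I_n -> B) : (forall i, phi (p i) = q i) ->
  forall a b, rel_H p a b -> rel_H q (phi a) (phi b).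
Proof.
move=> pq a b [i|i j ij|i j i1 ij|i j i0 j1];
  rewrite ?rmorphN !rmorphM !pq; by constructor.
Qed.

Lemma rel_Cl_morph (A B : pzRingType) (phi : {rmorphism A -> B})
    (c : 'I_n -> A) (d : 'I_n -> B) : (forall j, phi (c j) = d j) ->
  forall a b, rel_Cl c a b -> rel_Cl d (phi a) (phi b).
Proof.
move=> cd a b [j|i j ij]; rewrite !rmorphN ?rmorph1 !rmorphM !cd;
  by constructor.
Qed.

Definition lbl (j : 'I_n) : nat := j.+1.

Section MixedRelations.
Variables (A : algType C) (p c : 'I_n -> A).

Inductive rel_mixed : A -> A -> Prop :=
| rel_mixed_comm (i j : 'I_n) : lbl j <> i -> lbl j <> i.+1 ->
    rel_mixed (p i * c j) (c j * p i)
| rel_mixed_succ (i j k : 'I_n) :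
    (1 <= i)%N -> lbl j = i -> lbl k = i.+1 ->
    rel_mixed (p i * c k) (c j * p i)
| rel_mixed_same (i j k : 'I_n) :
    (1 <= i)%N -> lbl j = i -> lbl k = i.+1 ->
    rel_mixed ((p i + 1) * c j) (c k * (p i + 1))
| rel_mixed0 (i j : 'I_n) : i = 0%N :> nat -> lbl j = 1%N ->
    rel_mixed (p i * c j) ('i%C *: p i).

End MixedRelations.

(* Generators of HCl_n^B(0): inl i is pi_i, inr j is c_(j+1).                 *)
Definition pi_free (i : 'I_n) : freeAlg C ('I_n + 'I_n)%type := fgen C (inl i).
Definition c_free (j : 'I_n) : freeAlg C ('I_n + 'I_n)%type := fgen C (inr j).

Inductive rel_HCl :
  freeAlg C ('I_n + 'I_n)%type -> freeAlg C ('I_n + 'I_n)%type -> Prop :=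
| rel_HCl_H a b : rel_H pi_free a b -> rel_HCl a b
| rel_HCl_Cl a b : rel_Cl c_free a b -> rel_HCl a b
| rel_HCl_mixed a b : rel_mixed pi_free c_free a b -> rel_HCl a b.

Definition H0B := presAlg (rel_H (fgen C (X := 'I_n))).
Definition Cl := presAlg (rel_Cl (fgen C (X := 'I_n))).
Definition HCl0B := presAlg rel_HCl.
HB.instance Definition _ := GRing.PzRing.on H0B.
HB.instance Definition _ := GRing.Lmodule.on H0B.
HB.instance Definition _ := GRing.PzRing.on Cl.
HB.instance Definition _ := GRing.Lmodule.on Cl.
HB.instance Definition _ := GRing.PzRing.on HCl0B.
HB.instance Definition _ := GRing.Lmodule.on HCl0B.

Definition cl (j : 'I_n) : Cl := pgen _ j.

Definition H_to_HCl_free : {rmorphism freeAlg C 'I_n -> HCl0B} :=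
  pres_pi rel_HCl \o free_lift pi_free.
Definition Cl_to_HCl_free : {rmorphism freeAlg C 'I_n -> HCl0B} :=
  pres_pi rel_HCl \o free_lift c_free.

Lemma H_to_HCl_rel a b : rel_H (fgen C (X := 'I_n)) a b ->
  H_to_HCl_free a = H_to_HCl_free b.
Proof.
move=> ab; apply: (pres_rel (a := free_lift pi_free a)); apply: rel_HCl_H.
exact: (rel_H_morph (phi := free_lift pi_free) (free_liftE pi_free)).
Qed.

Lemma Cl_to_HCl_rel a b : rel_Cl (fgen C (X := 'I_n)) a b ->
  Cl_to_HCl_free a = Cl_to_HCl_free b.
Proof.
move=> ab; apply: (pres_rel (a := free_lift c_free a)); apply: rel_HCl_Cl.
exact: (rel_Cl_morph (phi := free_lift c_free) (free_liftE c_free)).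
Qed.

Definition H_to_HCl : {rmorphism H0B -> HCl0B} := pres_lift H_to_HCl_rel.
Definition Cl_to_HCl : {rmorphism Cl -> HCl0B} := pres_lift Cl_to_HCl_rel.

(* S_I = C eps_I with eps_I = 1; the argument I only selects the action.      *)
Definition simpleB of {set 'I_n} : Type := C.

Section SimpleModule.
Variable I : {set 'I_n}.

Definition simple_val (i : 'I_n) : C^o := if i \in I then -1 else 0.

Lemma simple_val_rel a b : rel_H simple_val a b -> a = b.
Proof.
case=> [i|i j ij|i j i1 ij|i j i0 j1]; rewrite /simple_val.
- by case: ifP; rewrite ?mulrNN ?mulr1 ?mulr0 ?oppr0 ?opprK.
- exact: mulrC.
- by case: ifP; case: ifP; rewrite ?(mulr0, mul0r).
- by case: ifP; case: ifP; rewrite ?(mulr0, mul0r).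
Qed.

Lemma simple_char_rel a b : rel_H (fgen C (X := 'I_n)) a b ->
  free_lift simple_val a = free_lift simple_val b.
Proof.
move=> ab; apply: simple_val_rel.
exact: (rel_H_morph (phi := free_lift simple_val) (free_liftE simple_val)).
Qed.

Definition simple_char : {rmorphism H0B -> C} := pres_lift simple_char_rel.

HB.instance Definition _ := GRing.Zmodule.on (simpleB I).

Definition simple_act (h : H0B) (z : simpleB I) : simpleB I :=
  simple_char h * (z : C).
Lemma simple_actA g h z : simple_act g (simple_act h z) = simple_act (g * h) z.
Proof. by rewrite /simple_act rmorphM mulrA. Qed.
Lemma simple_act1 : left_id 1 simple_act.
Proof. by move=> z; rewrite /simple_act rmorph1 mul1r. Qed.
Lemma simple_actDr : right_distributive simple_act +%R.
Proof. by move=> h y z; apply: mulrDr. Qed.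
Lemma simple_actDl z : {morph simple_act^~ z : g h / g + h}.
Proof. by move=> g h; rewrite /simple_act rmorphD mulrDl. Qed.
HB.instance Definition _ := GRing.Zmodule_isLmodule.Build H0B (simpleB I)
  simple_actA simple_act1 simple_actDr simple_actDl.

Definition indM := tensor H_to_HCl (simpleB I).
HB.instance Definition _ := GRing.Lmodule.on indM.

Definition simple_eps : simpleB I := (1 : C).
Definition eps : indM := tens H_to_HCl 1 simple_eps.

Definition cl_eps (x : Cl) : indM := Cl_to_HCl x *: eps.

(* M_I is free as a Cl_n-module on eps_I. This does not follow from the       *)
(* relations: if 1 < n and 0 \in I, then M_I = 0 (indM_eq0 below).            *)
Definition cl_free_on_eps : Prop := bijective cl_eps.

(* f c is the map x eps_I |-> x c eps_I.                                      *)
Definition is_fc (f : Cl -> indM -> indM) : Prop :=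
  forall c x, f c (cl_eps x) = cl_eps (x * c).

End SimpleModule.

Definition ValB (J : {set 'I_n}) : {set 'I_n} :=
  [set j : 'I_n | (lbl j \notin [seq val i | i in J]) &&
                  ((lbl j).-1 \in [seq val i | i in J])].

Section SubClifford.
Variable V : {set 'I_n}.

Inductive gen_by_c : Cl -> Prop :=
| gen_by_c_gen v : v \in V -> gen_by_c (cl v)
| gen_by_c1 : gen_by_c 1
| gen_by_cZD k x y : gen_by_c x -> gen_by_c y -> gen_by_c (k *: x + y)
| gen_by_cM x y : gen_by_c x -> gen_by_c y -> gen_by_c (x * y).

Definition in_ClV : {pred Cl} := fun x => `[< gen_by_c x >].

Lemma in_ClV_subring : subring_closed in_ClV.
Proof.
split=> [|x y|x y]; rewrite !unfold_in.
- exact/asboolT/gen_by_c1.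
- move=> /asboolP xV /asboolP yV; apply/asboolT.
  by rewrite addrC -scaleN1r; apply: gen_by_cZD.
- by move=> /asboolP xV /asboolP yV; apply/asboolT/gen_by_cM.
Qed.
Lemma in_ClV_submod : GRing.subsemimod_closed in_ClV.
Proof.
have zero_in : gen_by_c 0.
  rewrite -(addNr 1) -scaleN1r; apply: gen_by_cZD; exact: gen_by_c1.
split=> [|k x]; last first.
  rewrite !unfold_in => /asboolP xV; apply/asboolT.
  by rewrite -[_ *: _]addr0; apply: gen_by_cZD.
split=> [|x y]; rewrite !unfold_in; first exact/asboolT.
move=> /asboolP xV /asboolP yV; apply/asboolT.
by rewrite -[x]scale1r; apply: gen_by_cZD.
Qed.

Definition ClV := {x : Cl | in_ClV x}.
HB.instance Definition _ := SubType.on ClV.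
HB.instance Definition _ := Choice.on ClV.
HB.instance Definition _ :=
  GRing.SubChoice_isSubPzRing.Build Cl in_ClV ClV in_ClV_subring.
HB.instance Definition _ :=
  GRing.SubZmodule_isSubLmodule.Build C Cl in_ClV ClV in_ClV_submod.

End SubClifford.
End HeckeClifford.

Definition is_right_action (B : pzRingType) (M : zmodType)
    (act : M -> B -> M) : Prop :=
  [/\ forall m, act m 1 = m,
      forall m b b', act m (b * b') = act (act m b) b',
      forall m m' b, act (m + m') b = act m b + act m' b &
      forall m b b', act m (b + b') = act m b + act m b'].

(* For n >= 2 the relations pi_0 c_1 = sqrt(-1) pi_0, pi_0 c_2 = c_2 pi_0 and *)
(* c_1 c_2 = - c_2 c_1 force pi_0 = 0.                                        *)
Lemma pi0_eq0 (R : realType) (n : nat) (i : 'I_n) :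
  (1 < n)%N -> i = 0%N :> nat -> pgen (@rel_HCl R n) (inl i) = 0.
Proof.
move=> n1 i0; set p := pgen _ _.
pose c j := pgen (@rel_HCl R n) (inr j).
pose c1 : 'I_n := Ordinal (ltnW n1); pose c2 : 'I_n := Ordinal n1.
have E1 : p * c c1 = 'i%C *: p.
  rewrite /p /c /pgen -pres_piMr -pres_piZ; apply/pres_rel/rel_HCl_mixed.
  exact: (@rel_mixed0 _ _ _ (@pi_free _ _) (@c_free _ _)).
have E2 : p * c c2 = c c2 * p.
  rewrite /p /c /pgen -2!pres_piMr; apply/pres_rel/rel_HCl_mixed.
  by apply: (@rel_mixed_comm _ _ _ (@pi_free _ _) (@c_free _ _)); rewrite i0.
have E3 : c c1 * c c2 = - (c c2 * c c1).
  rewrite /p /c /pgen -2!pres_piMr -pres_piN; apply/pres_rel/rel_HCl_Cl.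
  exact: (@rel_Cl_anti _ _ (@c_free _ _)).
have E4 : c c2 * c c2 = -1.
  rewrite /p /c /pgen -pres_piMr -pres_pi1 -pres_piN; apply/pres_rel/rel_HCl_Cl.
  exact: (@rel_Cl_sq _ _ (@c_free _ _)).
have E5 : 'i%C *: (c c2 * p) = - ('i%C *: (c c2 * p)).
  have eq_pcc : p * (c c1 * c c2) = 'i%C *: (c c2 * p).
    by rewrite mulrA E1 -pres_scalerAl E2.
  by rewrite -[LHS]eq_pcc E3 mulrN mulrA E2 -mulrA E1 -pres_scalerAr.
have two_neq0 : (2%:R : R[i]) != 0 by rewrite Num.Theory.pnatr_eq0.
have E6 : 'i%C *: (c c2 * p) = 0.
  move: E5; set X := 'i%C *: _ => E5.
  have X2 : (2%:R : R[i]) *: X = 0.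
    by rewrite (natrD _ 1 1) scalerDl scale1r [Y in Y + _]E5 addNr.
  by rewrite -[LHS]scale1r -(mulVf two_neq0) -scalerA X2 scaler0.
have E7 : c c2 * p = 0.
  have := congr1 (fun z => - 'i%C *: z) E6.
  by rewrite scalerA mulNr -expr2 sqr_i opprK scale1r scaler0.
by rewrite -[LHS]opprK -[- p]mulN1r -E4 -mulrA E7 mulr0 oppr0.
Qed.

Lemma indM_eq0 (R : realType) (n : nat) (I : {set 'I_n}) (i : 'I_n) :
  (1 < n)%N -> i = 0%N :> nat -> i \in I -> forall m : indM R I, m = 0.
Proof.
move=> n1 i0 iI.
have charE : simple_char R I (pgen _ i) = -1.
  by rewrite [LHS]pres_liftE [LHS]free_liftE /simple_val iI.
have imE : H_to_HCl R n (pgen _ i) = 0.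
  rewrite -(pi0_eq0 R n1 i0) [LHS]pres_liftE.
  exact: (congr1 (pres_pi _) (free_liftE _ _)).
have tens0 (a : HCl0B R n) : tens (H_to_HCl R n) a (0 : simpleB R I) = 0.
  by apply: (addrI (tens (H_to_HCl R n) a 0)); rewrite -tensDr !addr0.
have tens_eq0 (a : HCl0B R n) (s : simpleB R I) : tens (H_to_HCl R n) a s = 0.
  have -> : s = pgen _ i *: (- s).
    by rewrite -[RHS]/(simple_char R I _ * _) charE mulN1r opprK.
  rewrite -tensM imE mulr0.
  by apply: (addrI (tens (H_to_HCl R n) 0 (- s))); rewrite -tensDl !addr0.
by apply: tens_ind => // a s q ->; rewrite tens_eq0 ?oppr0 addr0.
Qed.

(* Main.v *)
Require Import Defs.
From HB Require Import structures.
From mathcomp Require Import all_boot all_order all_algebra.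
From mathcomp Require Import boolp reals complex.
From mathcomp Require Import freeg monalg.

(* Let u = 1 - c_i c_(i+1). The Demazure-like rule for moving pi_i past Cl_n is
   inner: (2 pi_i + u) x = s_i(x) (2 pi_i + u), s_i swapping c_i and c_(i+1).
   Applied to eps_I, where 2 pi_i + u acts as the invertible element
   w = u or w = u - 2 of Cl_n, and after conjugating s_i by w, this becomes
     2 pi_i x eps_I = (w s(x) - u x) eps_I,
   where s is the automorphism changing the sign of the single generator c_i
   (if i notin I) or c_(i+1) (if i in I). Hence x eps_I is a pi_i-eigenvector
   with the eigenvalue of eps_I iff s(x) = x, and the subalgebra of Cl_n fixed
   by all the sign changes occurring here is Cl_V. For pi_0 there is nothing to
   check if 0 notin I, while for 0 in I either M_I = 0 or n = 1.
   An endomorphism is determined by the image of eps_I, which may be any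
   x eps_I on which each pi_i acts as on eps_I. *)

Set Implicit Arguments.
Unset Strict Implicit.
Unset Printing Implicit Defensive.

Import GRing.Theory.

Local Open Scope ring_scope.

(** * Induction along words in the generators, peeled off from the left *)

Lemma freeAlg_ind (K : comNzRingType) (X : choiceType)
    (P : freeAlg K X -> Prop) :
  P 1 -> (forall k a b, P a -> P b -> P (k *: a + b)) ->
  (forall x a, P a -> P (fgen K x * a)) -> forall a, P a.
Proof.
move=> P1 PZD PM a.
have P0 : P 0 by rewrite -(subrr 1) addrC -scaleN1r; apply: PZD.
have PU (m : {fmonom X}) : P (mkmalgU m 1).
  case: m => s; elim: s => [|x s IH].
    have -> : FMonom [::] = mone :> {fmonom X} by apply/val_inj; rewrite /= fm1.
    exact: P1.
  have -> : mkmalgU (FMonom (x :: s)) 1 =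
      fgen K x * (mkmalgU (FMonom s) 1 : freeAlg K X).
    unlock fgen; rewrite [RHS]malgM_def fgmulUU mulr1; congr mkmalgU.
    by apply/val_inj; rewrite /= fmM fmU.
  exact: PM.
rewrite [a]monalgE; elim/big_rec: _ => // m b _ Pb.
have -> : mkmalgU m a@_m = a@_m *: (mkmalgU m 1 : freeAlg K X).
  by rewrite -[RHS]mul_malgC malgM_def fgmulUU mul1m mulr1.
exact: PZD.
Qed.

Lemma presAlg_ind (K : comNzRingType) (X : choiceType)
    (rel : freeAlg K X -> freeAlg K X -> Prop) (P : presAlg rel -> Prop) :
  P 1 -> (forall k a b, P a -> P b -> P (k *: a + b)) ->
  (forall x a, P a -> P (pgen rel x * a)) -> forall a, P a.
Proof.
move=> P1 PZD PM a; rewrite -[a]pres_reprK; elim/freeAlg_ind: (pres_repr a).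
- exact: P1.
- by move=> k b c Pb Pc; rewrite pres_piD pres_piZ; apply: PZD.
- by move=> x b Pb; rewrite pres_piMr; apply: PM.
Qed.

(** * Sign-change automorphisms of the Clifford algebra *)

Section SignChange.
Variables (R : realType) (n : nat).
Local Notation Cl := (Cl R n).
Local Notation cl := (cl R).

Lemma cl_sq (j : 'I_n) : cl j * cl j = -1.
Proof.
by rewrite /cl /pgen -pres_piMr -pres_pi1 -pres_piN; apply/pres_rel/rel_Cl_sq.
Qed.

Lemma cl_anti (j k : 'I_n) : j != k -> cl j * cl k = - (cl k * cl j).
Proof.
move=> jk; rewrite /cl /pgen -2!pres_piMr -pres_piN.
exact/pres_rel/rel_Cl_anti.
Qed.

Variable j : 'I_n.

Definition flip_gen (k : 'I_n) : freeAlg R[i] 'I_n :=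
  if k == j then - fgen _ k else fgen _ k.

Definition flip_free : {rmorphism freeAlg R[i] 'I_n -> Cl} :=
  pres_pi _ \o free_lift flip_gen.

Lemma flip_freeE k : flip_free (fgen _ k) = if k == j then - cl k else cl k.
Proof.
rewrite /flip_free /= free_liftE /flip_gen; case: ifP => // _.
exact: pres_piN.
Qed.

Lemma flip_freeM a b : flip_free (a * b) = flip_free a * flip_free b.
Proof. by rewrite /flip_free /= free_liftM; apply: pres_piMr. Qed.

Lemma flip_freeN a : flip_free (- a) = - flip_free a.
Proof. by rewrite /flip_free /= free_liftN; apply: pres_piN. Qed.

Lemma flip_free1 : flip_free 1 = 1.
Proof. by rewrite /flip_free /= free_lift1. Qed.

(** Squares keep their sign, and both sides of an anticommutation relation pick up the same one. *)
Lemma flip_rel a b : rel_Cl (fgen R[i] (X := 'I_n)) a b ->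
  flip_free a = flip_free b.
Proof.
have M k l : flip_free (fgen _ k * fgen _ l) =
    (if k == j then - cl k else cl k) * (if l == j then - cl l else cl l).
  by rewrite flip_freeM 2!flip_freeE.
case=> [k|k l kl].
  rewrite flip_freeN flip_free1 M.
  by case: ifP => _; rewrite ?mulrNN cl_sq.
rewrite [LHS]M [RHS]flip_freeN [X in _ = - X]M.
by case: ifP => _; case: ifP => _;
  rewrite ?mulrNN ?mulrN ?mulNr (cl_anti kl) ?opprK.
Qed.

Definition flip : {rmorphism Cl -> Cl} := pres_lift flip_rel.

Lemma flip_cl k : flip (cl k) = if k == j then - cl k else cl k.
Proof. by rewrite [LHS]pres_liftE flip_freeE. Qed.

Lemma flipZ k x : flip (k *: x) = k *: flip x.
Proof.
rewrite -[x]pres_reprK -pres_piZ [flip (pres_pi _ (_ *: _))]pres_liftE.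
rewrite [X in _ = _ *: X]pres_liftE /flip_free /= free_liftZ.
exact: pres_piZ.
Qed.

Lemma flipM x y : flip (x * y) = flip x * flip y.
Proof. exact: rmorphM. Qed.

Lemma flipD x y : flip (x + y) = flip x + flip y.
Proof. exact: raddfD. Qed.

Lemma flip1 : flip 1 = 1.
Proof. exact: rmorph1. Qed.

End SignChange.

(** * Cancelling a factor 2 *)

Lemma addxx_eq0 (F : numFieldType) (V : lmodType F) (x : V) :
  x + x = 0 -> x = 0.
Proof.
move/eqP; rewrite -[x]scale1r -scalerDl scaler_eq0 -[1 + 1]/(2%:R).
by rewrite Num.Theory.pnatr_eq0 /= => /eqP ->; rewrite scaler0.
Qed.

Lemma addxx_inj (F : numFieldType) (V : lmodType F) (x y : V) :
  x + x = y + y -> x = y.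
Proof.
move=> xy; apply/eqP; rewrite -subr_eq0; apply/eqP/addxx_eq0.
by rewrite addrACA xy -opprD subrr.
Qed.

(** * [Cl_V] as the fixed subalgebra of sign changes *)

Section CliffordSubalgebras.
Variables (R : realType) (n : nat).
Local Notation Cl := (Cl R n).
Local Notation cl := (cl R).
Implicit Types (V : {set 'I_n}) (x y : Cl).

Lemma Cl_ind (P : Cl -> Prop) : P 1 ->
  (forall k x y, P x -> P y -> P (k *: x + y)) ->
  (forall j x, P x -> P (cl j * x)) -> forall x, P x.
Proof. exact: presAlg_ind. Qed.

Lemma gen_by_c0 V : gen_by_c V (0 : Cl).
Proof.
by rewrite -(addNr 1) -scaleN1r; apply: gen_by_cZD; apply: gen_by_c1.
Qed.

Lemma gen_by_cD V x y : gen_by_c V x -> gen_by_c V y -> gen_by_c V (x + y).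
Proof. by move=> xV yV; rewrite -[x]scale1r; apply: gen_by_cZD. Qed.

Lemma gen_by_cN V x : gen_by_c V x -> gen_by_c V (- x).
Proof.
move=> xV; rewrite -[- x]addr0 -scaleN1r.
by apply: gen_by_cZD => //; apply: gen_by_c0.
Qed.

Lemma flip_id V j x : j \notin V -> gen_by_c V x -> flip R j x = x.
Proof.
move=> jV; elim=> [v vV||k {}x y _ IHx _ IHy|{}x y _ IHx _ IHy].
- by rewrite flip_cl; case: eqP => // vj; rewrite vj (negPf jV) in vV.
- exact: flip1.
- by rewrite flipD flipZ IHx IHy.
- by rewrite flipM IHx IHy.
Qed.

Lemma gen_by_c_mulr_cl V j x : j \notin V -> gen_by_c V x ->
  exists2 y, gen_by_c V y & x * cl j = cl j * y.
Proof.
move=> jV; elim=> [v vV||k {}x x' _ [y yV E] _ [y' y'V E']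
                  |{}x x' _ [y yV E] _ [y' y'V E']].
- exists (- cl v); first exact/gen_by_cN/gen_by_c_gen.
  by rewrite mulrN cl_anti //; apply: contraNneq jV => <-.
- by exists 1; [apply: gen_by_c1 | rewrite mul1r mulr1].
- exists (k *: y + y'); first exact: gen_by_cZD.
  rewrite mulrDl mulrDr -[_ *: x * _]pres_scalerAl E E'.
  by rewrite -[cl j * (_ *: _)]pres_scalerAr.
- exists (y * y'); first exact: gen_by_cM.
  by rewrite -mulrA E' mulrA E mulrA.
Qed.

(** Any product is reordered by moving [c_j] to the left past the other generators and using
    [c_j^2 = -1]. *)
Lemma gen_by_c_split V j x : gen_by_c V x ->
  exists a b, [/\ gen_by_c (V :\ j) a, gen_by_c (V :\ j) b & x = a + cl j * b].
Proof.
have jVj : j \notin V :\ j by rewrite setD11.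
elim=> [v vV||k {}x x' _ [a [b [aV bV ->]]] _ [a' [b' [aV' bV' ->]]]
       |{}x x' _ [a [b [aV bV ->]]] _ [a' [b' [aV' bV' ->]]]].
- have [->|vj] := eqVneq v j.
    exists 0, 1; rewrite add0r mulr1.
    by split; [apply: gen_by_c0 | apply: gen_by_c1 |].
  exists (cl v), 0; rewrite mulr0 addr0; split => //; last exact: gen_by_c0.
  by apply: gen_by_c_gen; rewrite in_setD1 vj.
- exists 1, 0; rewrite mulr0 addr0.
  by split; [apply: gen_by_c1 | apply: gen_by_c0 |].
- exists (k *: a + a'), (k *: b + b'); split; try exact: gen_by_cZD.
  by rewrite scalerDr mulrDr addrACA -[cl j * (_ *: _)]pres_scalerAr.
- have [a1 a1V Ea] := gen_by_c_mulr_cl jVj aV.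
  have [b1 b1V Eb] := gen_by_c_mulr_cl jVj bV.
  (* Expand [(a + c_j b)(a' + c_j b')] with [a c_j = c_j a1] and [b c_j = c_j b1]. *)
  exists (a * a' - b1 * b'), (a1 * b' + b * a'); split.
  + by apply: gen_by_cD; [|apply: gen_by_cN]; apply: gen_by_cM.
  + by apply: gen_by_cD; apply: gen_by_cM.
  + rewrite mulrDl !mulrDr !mulrA Ea -(mulrA (cl j) b (cl j)) Eb.
    rewrite (mulrA (cl j)) cl_sq.
    by rewrite !mulN1r mulNr -!addrA; congr (_ + _); rewrite addrA addrC.
Qed.

(** Write [x = a + c_j b]. The sign change negates [c_j b], so a fixed [x] has [2 c_j b = 0] and
    equals [a]. *)
Lemma gen_by_c_setD1 V j x :
  gen_by_c V x -> flip R j x = x -> gen_by_c (V :\ j) x.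
Proof.
move=> /(gen_by_c_split j) [a [b [aV bV ->]]].
have jVj : j \notin V :\ j by rewrite setD11.
rewrite flipD flipM flip_cl eqxx (flip_id jVj aV) (flip_id jVj bV) mulNr.
move/addrI => /eqP; rewrite eq_sym -addr_eq0 => /eqP/addxx_eq0 ->.
by rewrite addr0.
Qed.

Lemma gen_by_cT x : gen_by_c setT x.
Proof.
elim/Cl_ind: x => [|k x y IHx IHy|j x IHx].
- exact: gen_by_c1.
- exact: gen_by_cZD.
- by apply: gen_by_cM => //; apply: gen_by_c_gen; rewrite in_setT.
Qed.

(** For the converse, start from all of [Cl_n] and discard the generators outside [V] one at a
    time. *)
Lemma gen_by_cP V x : gen_by_c V x <-> forall j, j \notin V -> flip R j x = x.
Proof.
split=> [xV j jV|flip_x]; first exact: (flip_id jV xV).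
suff E (s : seq 'I_n) : {in s, forall j, flip R j x = x} ->
    gen_by_c [set j | j \notin s] x.
  have -> : V = [set j | j \notin enum (~: V)].
    by apply/setP => j; rewrite inE mem_enum inE negbK.
  by apply: E => j; rewrite mem_enum inE; apply: flip_x.
elim: s => [|j s IH] fix_s.
  have -> : [set j : 'I_n | j \notin [::]] = setT.
    by apply/setP => j; rewrite !inE.
  exact: gen_by_cT.
have -> : [set k | k \notin j :: s] = [set k | k \notin s] :\ j.
  by apply/setP => k; rewrite !inE negb_or.
apply: gen_by_c_setD1; last by apply: fix_s; rewrite mem_head.
by apply: IH => k ks; apply: fix_s; rewrite in_cons ks orbT.
Qed.

End CliffordSubalgebras.

(** * Relations in [HCl_n^B(0)] and the action on [eps_I] *)

Section HeckeCliffordRelations.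
Variables (R : realType) (n : nat).
Local Notation Cl := (Cl R n).
Local Notation cl := (cl R).
Local Notation HCl := (HCl0B R n).

Definition hpi (i : 'I_n) : HCl := pgen (@rel_HCl R n) (inl i).
Definition hcl (j : 'I_n) : HCl := pgen (@rel_HCl R n) (inr j).
Local Notation iota := (Cl_to_HCl R n).

Lemma iota_cl j : iota (cl j) = hcl j.
Proof. by rewrite [LHS]pres_liftE [LHS](congr1 _ (free_liftE _ _)). Qed.

(** The scalar is written as a central element because complex numbers act on [M_I] through
    [kscale]. *)
Lemma iotaZ k x : iota (k *: x) = (k *: (1 : HCl)) * iota x.
Proof.
rewrite -[x]pres_reprK -pres_piZ [X in X = _]pres_liftE.
rewrite [X in _ = _ * X]pres_liftE /= free_liftZ.
by rewrite -[RHS]pres_scalerAl mul1r -[RHS]pres_piZ.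
Qed.

Lemma hpi_comm (i j : 'I_n) : lbl j <> i -> lbl j <> i.+1 ->
  hpi i * hcl j = hcl j * hpi i.
Proof.
move=> ji ji1; rewrite /hpi /hcl /pgen -2!pres_piMr.
apply/pres_rel/rel_HCl_mixed.
exact: (@rel_mixed_comm _ _ _ (@pi_free _ _) (@c_free _ _)).
Qed.

Lemma hpi_succ (i j k : 'I_n) : (1 <= i)%N -> lbl j = i -> lbl k = i.+1 ->
  hpi i * hcl k = hcl j * hpi i.
Proof.
move=> i1 ji ki; rewrite /hpi /hcl /pgen -2!pres_piMr.
apply/pres_rel/rel_HCl_mixed.
exact: (@rel_mixed_succ _ _ _ (@pi_free _ _) (@c_free _ _)).
Qed.

Lemma hpi_same (i j k : 'I_n) : (1 <= i)%N -> lbl j = i -> lbl k = i.+1 ->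
  (hpi i + 1) * hcl j = hcl k * (hpi i + 1).
Proof.
move=> i1 ji ki.
rewrite /hpi /hcl /pgen -pres_pi1 -pres_piD -2!pres_piMr.
apply/pres_rel/rel_HCl_mixed.
exact: (@rel_mixed_same _ _ _ (@pi_free _ _) (@c_free _ _)).
Qed.

Lemma hpi_zero (i j : 'I_n) : i = 0%N :> nat -> lbl j = 1%N ->
  hpi i * hcl j = 'i%C *: hpi i.
Proof.
move=> i0 j1; rewrite /hpi /hcl /pgen -pres_piMr -pres_piZ.
apply/pres_rel/rel_HCl_mixed.
exact: (@rel_mixed0 _ _ _ (@pi_free _ _) (@c_free _ _)).
Qed.

Lemma HCl_ind (P : HCl -> Prop) : P 1 ->
  (forall k a b, P a -> P b -> P (k *: a + b)) ->
  (forall i a, P a -> P (hpi i * a)) ->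
  (forall j a, P a -> P (hcl j * a)) -> forall a, P a.
Proof.
move=> P1 PZD Ppi Pcl; apply: presAlg_ind => // -[i|j] a.
- exact: Ppi.
- exact: Pcl.
Qed.

Variable I : {set 'I_n}.
Local Notation M := (indM R I).
Local Notation e := (@cl_eps R n I).

Lemma cl_epsD x y : e (x + y) = e x + e y.
Proof. by rewrite /cl_eps raddfD scalerDl. Qed.
Lemma cl_eps0 : e 0 = 0.
Proof. by rewrite /cl_eps raddf0 scale0r. Qed.
Lemma cl_epsN x : e (- x) = - e x.
Proof. by rewrite /cl_eps raddfN scaleNr. Qed.
Lemma cl_epsM x y : e (x * y) = iota x *: e y.
Proof. by rewrite /cl_eps rmorphM scalerA. Qed.
Lemma cl_eps_clM j y : e (cl j * y) = hcl j *: e y.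
Proof. by rewrite cl_epsM iota_cl. Qed.
Lemma cl_epsZ k x : e (k *: x) = kscale k (e x).
Proof. by rewrite /cl_eps iotaZ /kscale scalerA. Qed.
Lemma cl_eps1 : e 1 = eps R I.
Proof. by rewrite /cl_eps rmorph1 scale1r. Qed.

Definition chi (i : 'I_n) (m : M) : M := if i \in I then - m else 0.

(** As [pi_i] comes from [H_n^B(0)], it crosses the tensor sign and acts on [S_I] by its
    character. *)
Lemma hpi_eps i : hpi i *: eps R I = chi i (eps R I).
Proof.
have E : hpi i = H_to_HCl R n (pgen _ i).
  rewrite [RHS]pres_liftE; apply/esym.
  exact: (congr1 (pres_pi _) (free_liftE _ _)).
have charE : simple_char R I (pgen _ i) = simple_val R I i.
  by rewrite [LHS]pres_liftE [LHS]free_liftE.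
have tens0 : tens (H_to_HCl R n) (1 : HCl) (0 : simpleB R I) = 0.
  by apply: (addrI (tens (H_to_HCl R n) 1 0)); rewrite -tensDr !addr0.
rewrite [LHS]tens_actE mulr1 -[hpi i]mul1r E tensM.
have -> : pgen (rel_H (fgen R[i] (X := 'I_n))) i *: simple_eps R I =
    simple_val R I i * (1 : R[i]) :> simpleB R I.
  by rewrite -charE.
rewrite mulr1 /chi /simple_val; case: ifP => _ //.
apply: (addrI (eps R I)); rewrite subrr -tensDr.
have -> : (simple_eps R I + (-1 : R[i])) = 0 :> simpleB R I by apply: subrr.
exact: tens0.
Qed.

End HeckeCliffordRelations.

(** * Moving [pi_i] past Clifford elements in [M_I] *)

Section InducedModule.
Variables (R : realType) (n : nat) (I : {set 'I_n}).
Local Notation Cl := (Cl R n).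
Local Notation cl := (cl R).
Local Notation M := (indM R I).
Local Notation e := (@cl_eps R n I).
Local Notation hpi := (hpi R).
Local Notation hcl := (hcl R).
Local Notation V := (ValB (~: I)).

Lemma scale_cl_epsZD (a : HCl0B R n) k x y :
  a *: e (k *: x + y) = kscale k (a *: e x) + a *: e y.
Proof.
rewrite cl_epsD cl_epsZ [LHS]scalerDr; congr (_ + _).
exact/esym/kscale_comm.
Qed.

(** Moving [pi_0] through [x] costs only factors [sqrt(-1)], and it then kills [eps_I]. *)
Lemma hpi_zero_notin (i : 'I_n) x :
  i = 0%N :> nat -> i \notin I -> hpi i *: e x = 0.
Proof.
move=> i0 iI; elim/Cl_ind: x => [|k x y IHx IHy|j x IHx].
- by rewrite cl_eps1 hpi_eps /chi (negPf iI).
- by rewrite scale_cl_epsZD [X in kscale _ X]IHx IHy /kscale scaler0 addr0.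
(* Since [i = 0], the element [cl i] is [c_1], the one generator not commuting with [pi_0]. *)
rewrite cl_eps_clM scalerA; have [ji|ji] := eqVneq j i.
  rewrite hpi_zero ?ji /lbl ?i0 //.
  by rewrite -[hpi i]mul1r pres_scalerAl -scalerA IHx scaler0.
rewrite hpi_comm; first by rewrite -scalerA IHx scaler0.
  by rewrite i0.
by rewrite /lbl i0 => -[j0]; case/eqP: ji; apply/val_inj; rewrite /= i0.
Qed.

Lemma scalerMDr (a b : HCl0B R n) (m : M) :
  (a * b) *: m + (a * b) *: m = a *: (b *: m + b *: m).
Proof. by rewrite scalerDr scalerA. Qed.

(* With lbl h = i, the element cl h is the c_i of the paper and cl i is its
   c_(i+1). *)
Section Succ.
Variables i h : 'I_n.
Hypothesis hi : lbl h = i.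
Let i_gt0 : (1 <= i)%N. Proof. by rewrite -hi. Qed.
Let neq_hi : h != i.
Proof. by apply/eqP => h_i; move: hi; rewrite h_i /lbl => /esym/n_Sn. Qed.

Definition flip_idx : 'I_n := if i \in I then i else h.
Local Notation c := (cl h).
Local Notation c' := (cl i).
Definition tw_u : Cl := 1 - c * c'.
(** The Clifford element by which [2 pi_i + tw_u] acts on [eps_I]. *)
Definition tw_w : Cl := (if i \in I then -1 else 1) - c * c'.

Let ccc : c * c' * c = c'.
Proof. by rewrite cl_anti // mulNr -mulrA cl_sq mulrN1 opprK. Qed.
Let ccc' : c * c' * c' = - c.
Proof. by rewrite -mulrA cl_sq mulrN1. Qed.
Let c'cc : c' * (c * c') = c.
Proof.
by rewrite mulrA cl_anti 1?eq_sym // mulNr -mulrA cl_sq mulrN1 opprK.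
Qed.
Let cccl : c * (c * c') = - c'.
Proof. by rewrite mulrA cl_sq mulN1r. Qed.

(** With [tw_w_flip_i] and [tw_comm], this checks on generators that conjugation by [tw_w] turns the
    sign change into the swap of [c] and [c']. *)
Lemma tw_w_flip_h : tw_w * flip R flip_idx c = c' * tw_w.
Proof.
rewrite /tw_w flip_cl /flip_idx mulrBr c'cc; case: ifP => iI.
  by rewrite (negPf neq_hi) mulrBl ccc mulN1r mulrN1 addrC.
by rewrite eqxx mulrN mulrBl ccc mul1r mulr1 opprB.
Qed.

Lemma tw_w_flip_i : tw_w * flip R flip_idx c' = c * tw_w.
Proof.
rewrite /tw_w flip_cl /flip_idx mulrBr cccl; case: ifP => iI.
  by rewrite eqxx !mulrN mulrBl ccc' mulN1r mulr1 opprB opprK.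
by rewrite eq_sym (negPf neq_hi) mulrBl ccc' mul1r mulr1 !opprK addrC.
Qed.

Lemma tw_comm k : k != h -> k != i -> (c * c') * cl k = cl k * (c * c').
Proof.
move=> kh ki; rewrite -mulrA (@cl_anti _ _ i) 1?eq_sym // mulrN (mulrA c).
by rewrite (@cl_anti _ _ h) 1?eq_sym // mulNr opprK mulrA.
Qed.

Lemma tw_u_i : c * tw_u = tw_u * c'.
Proof. by rewrite /tw_u mulrBr mulrBl cccl ccc' mulr1 mul1r !opprK addrC. Qed.

(** [tw_u] absorbs the error term of [pi_i c = c' pi_i + c' - c], which occurs doubled. *)
Lemma tw_u_h : - (c' * tw_u) + (c' - c + (c' - c)) = - (tw_u * c).
Proof.
rewrite /tw_u mulrBr mulrBl c'cc ccc mulr1 mul1r !opprB.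
by rewrite addrA -[c - c']opprB addNr add0r.
Qed.

(** With [s = 1] or [s = -1], [(s + c c')(s - c c') = s^2 - (c c')^2 = 2], because
    [(c c')^2 = -1]. *)
Lemma tw_w_reg x : tw_w * x = 0 -> x = 0.
Proof.
move=> wx0; apply: addxx_eq0.
pose s : Cl := if i \in I then -1 else 1.
have ww : (s + c * c') * tw_w = 1 + 1.
  have sc : (c * c') * s = s * (c * c').
    by rewrite /s; case: ifP; rewrite ?mulN1r ?mulrN1 ?mul1r ?mulr1.
  rewrite /tw_w -/s mulrDl !mulrBr sc addrA subrK -(mulrA c) c'cc cl_sq opprK.
  by rewrite /s; case: ifP; rewrite ?mulrNN mulr1.
by rewrite -[x]mul1r -mulrDl -ww -mulrA wx0 mulr0.
Qed.

(** Induction on [x]: [tw_w - tw_u] acts on [eps_I] as [2 pi_i], and the twist identities above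
    carry each new left factor through. *)
Lemma hpi_cl_eps x : hpi i *: e x + hpi i *: e x =
  e (tw_w * flip R flip_idx x - tw_u * x).
Proof.
elim/Cl_ind: x => [|k x y IHx IHy|k y IHy].
- rewrite flip1 !mulr1 cl_eps1 hpi_eps /chi /tw_w /tw_u.
  case: ifP => _; last by rewrite subrr addr0 cl_eps0.
  by rewrite opprB addrA subrK cl_epsD cl_epsN cl_eps1.
- rewrite flipD flipZ scale_cl_epsZD addrACA.
  transitivity (kscale k (hpi i *: e x + hpi i *: e x)
                + (hpi i *: e y + hpi i *: e y)).
    by congr (_ + _); exact/esym/kscaleDr.
  rewrite [X in kscale _ X]IHx [X in _ + X]IHy -cl_epsZ -cl_epsD.
  congr cl_eps.
  rewrite !mulrDr -[tw_w * (_ *: _)]pres_scalerAr.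
  rewrite -[tw_u * (_ *: _)]pres_scalerAr opprD addrACA.
  by rewrite scalerBr.
rewrite flipM (mulrA tw_w) (mulrA tw_u) cl_eps_clM scalerA.
have [->|ki] := eqVneq k i.
  rewrite (hpi_succ R i_gt0 hi (erefl (lbl i))).
  rewrite scalerMDr IHy -cl_eps_clM.
  move: (flip R flip_idx y) {IHy} => sy.
  congr cl_eps; rewrite tw_w_flip_i mulrBr.
  by rewrite [X in X - _]mulrA [X in _ - X]mulrA tw_u_i.
have [->|kh] := eqVneq k h.
  (* Expansion of [(pi_i + 1) c = c' (pi_i + 1)]. *)
  have -> : hpi i * hcl h = hcl i * hpi i + hcl i - hcl h.
    have := hpi_same R i_gt0 hi (erefl (lbl i)).
    by rewrite mulrDl mul1r mulrDr mulr1 => <-; rewrite addrK.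
  have -> : (hcl i * hpi i + hcl i - hcl h) *: e y +
      (hcl i * hpi i + hcl i - hcl h) *: e y =
      hcl i *: (hpi i *: e y + hpi i *: e y) + e ((c' - c) * y + (c' - c) * y).
    rewrite -addrA [X in X + _]scalerDl [X in _ + X]scalerDl addrACA scalerMDr.
    by rewrite scalerBl -2!cl_eps_clM -cl_epsN -cl_epsD -mulrBl -cl_epsD.
  rewrite IHy -cl_eps_clM -cl_epsD; congr cl_eps.
  move: (flip R flip_idx y) {IHy} => sy.
  rewrite tw_w_flip_h mulrBr -addrA; congr (_ + _); first exact: mulrA.
  by rewrite mulrA -mulNr -!mulrDl tw_u_h mulNr.
(* Any other generator commutes with [pi_i], [tw_u] and [tw_w] and keeps its sign. *)
rewrite hpi_comm; last 2 first.
- by rewrite -hi => -[kh']; case/eqP: kh; apply/val_inj.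
- by move=> [ki']; case/eqP: ki; apply/val_inj.
rewrite scalerMDr IHy -cl_eps_clM; congr cl_eps.
move: (flip R flip_idx y) {IHy} => sy.
have jk : flip R flip_idx (cl k) = cl k.
  rewrite flip_cl /flip_idx.
  by case: (i \in I); rewrite ?(negPf kh) ?(negPf ki).
rewrite jk mulrBr; congr (_ - _); rewrite mulrA; congr (_ * _).
  rewrite /tw_w mulrBr mulrBl tw_comm //; congr (_ - _).
  by case: ifP => _; rewrite ?mulN1r ?mulrN1 ?mul1r ?mulr1.
by rewrite /tw_u mulrBr mulrBl tw_comm // mul1r mulr1.
Qed.

End Succ.
End InducedModule.

(** Here [j] stands for [v = j + 1]. For [v = n] there is no index [k], and the first condition is
    vacuous. *)
Lemma in_ValB (n : nat) (J : {set 'I_n}) (j : 'I_n) :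
  (j \in ValB J) =
  [forall k : 'I_n, (k == j.+1 :> nat) ==> (k \notin J)] && (j \in J).
Proof.
rewrite inE /lbl /= (mem_map val_inj) mem_enum; congr (_ && _).
apply/idP/forallP => [jJ k|jJ]; last first.
  apply/negP => /mapP [k]; rewrite mem_enum => kJ jk.
  by have := jJ k; rewrite -jk eqxx kJ.
apply/implyP => /eqP kj; apply: contraNN jJ => kJ.
by rewrite -kj; apply/mapP; exists k; rewrite ?mem_enum.
Qed.

(** * The sign changes that occur, and the exceptional generator [pi_0] *)

Section EndInduced.
Variables (R : realType) (n : nat) (I : {set 'I_n}).
Local Notation Cl := (Cl R n).
Local Notation cl := (cl R).
Local Notation M := (indM R I).
Local Notation e := (@cl_eps R n I).
Local Notation hpi := (hpi R).
Local Notation hcl := (hcl R).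
Local Notation V := (ValB (~: I)).

Lemma flip_idx_notin (i h : 'I_n) : lbl h = i -> flip_idx I i h \notin V.
Proof.
move=> hi; rewrite /flip_idx in_ValB; case: (boolP (i \in I)) => iI.
  by rewrite !inE iI andbF.
apply/negP => /andP [/forallP/(_ i)]; rewrite -hi /lbl eqxx /=.
by rewrite !inE iI.
Qed.

(** Converse to [flip_idx_notin]: the sign of [cl j] is changed by [pi_j] in the first case, if
    [j > 0], and by [pi_(j+1)] in the second. *)
Lemma notin_ValBC (j : 'I_n) : j \notin V ->
  j \in I \/ exists2 i : 'I_n, lbl j = i & i \notin I.
Proof.
rewrite in_ValB in_setC; case: (boolP (j \in I)) => jI; first by left.
rewrite andbT => /forallPn [k]; rewrite negb_imply in_setC !negbK.
by case/andP => /eqP kj kI; right; exists k.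
Qed.

Lemma ord_pred_lbl (i : 'I_n) : i != 0%N :> nat -> exists h : 'I_n, lbl h = i.
Proof.
rewrite -lt0n => i0.
have lt_n : (i.-1 < n)%N by rewrite prednK // ltnW.
by exists (Ordinal lt_n); rewrite /lbl /= prednK.
Qed.

(** If [n > 1], then [M_I = 0]; if [n = 1], then [V] is empty and [Cl_V] consists of scalars. *)
Lemma gen_by_c_scalar (i : 'I_n) c : i = 0%N :> nat -> i \in I ->
  gen_by_c V c -> (forall m : M, m = 0) \/ exists k, c = k *: (1 : Cl).
Proof.
move=> i0 iI cV; have [n1|n1] := ltnP 1 n.
  by left; apply: indM_eq0 iI.
right; elim: cV => [v|| k x y _ [l ->] _ [l' ->] | x y _ [l ->] _ [l' ->]].
- have -> : v = i.
    apply/val_inj; rewrite /= i0; apply/eqP; rewrite -leqn0 -ltnS.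
    exact: leq_trans (ltn_ord v) n1.
  by rewrite in_ValB in_setC iI andbF.
- by exists 1; rewrite scale1r.
- by exists (k * l + l'); rewrite scalerA -scalerDl.
- exists (l * l').
  by rewrite -[LHS]pres_scalerAl mul1r scalerA.
Qed.

(** For [n = 1], the relation [pi_0 c_1 = sqrt(-1) pi_0] reduces everything to multiples of
    [pi_0 eps_I = - eps_I]. *)
Lemma hpi_zero_in (i : 'I_n) x : i = 0%N :> nat -> i \in I ->
  exists k, hpi i *: e x = e (k *: (1 : Cl)).
Proof.
move=> i0 iI; have [n1|n1] := ltnP 1 n.
  exists 0; rewrite [LHS](indM_eq0 n1 i0 iI).
  exact/esym/(indM_eq0 n1 i0 iI).
elim/Cl_ind: x => [|k x y [l IHx] [l' IHy]|j x [l IHx]].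
- by exists (-1); rewrite scaleN1r cl_epsN cl_eps1 hpi_eps /chi iI.
- exists (k * l + l'); rewrite scale_cl_epsZD.
  rewrite [X in kscale _ X]IHx [X in _ + X]IHy -cl_epsZ -cl_epsD.
  by congr cl_eps; rewrite scalerA -scalerDl.
have -> : j = i.
  apply/val_inj; rewrite /= i0; apply/eqP; rewrite -leqn0 -ltnS.
  exact: leq_trans (ltn_ord j) n1.
have lbl1 : lbl i = 1%N by rewrite /lbl i0.
exists ('i%C * l); rewrite cl_eps_clM [LHS]scalerA (hpi_zero R i0 lbl1).
have -> : 'i%C *: hpi i = ('i%C *: (1 : HCl0B R n)) * hpi i.
  by rewrite -[RHS]pres_scalerAl mul1r.
rewrite -[LHS]scalerA [X in _ *: X]IHx -[LHS]/(kscale _ _) -cl_epsZ.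
by congr cl_eps; rewrite scalerA.
Qed.

(** * Eigenvectors when [M_I] is free on [eps_I], with [g] the Clifford coordinate *)

Variable g : M -> Cl.
Hypotheses (eK : cancel e g) (gK : cancel g e).

Lemma indM_addxx_inj (m m' : M) : m + m = m' + m' -> m = m'.
Proof.
rewrite -(gK m) -(gK m'); move: (g m) (g m') => x y E.
have Exy : e (x + x) = e (y + y) by rewrite cl_epsD E -cl_epsD.
congr cl_eps; exact: addxx_inj (can_inj eK Exy).
Qed.

Lemma cl_eps_tw (i h : 'I_n) x :
  e (tw_w R I i h * x - tw_u R i h * x) = chi i (e x) + chi i (e x).
Proof.
rewrite -mulrBl /tw_w /tw_u /chi opprB addrA subrK; case: (i \in I).
  by rewrite mulrBl mulN1r mul1r cl_epsD !cl_epsN.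
by rewrite subrr mul0r cl_eps0 addr0.
Qed.

(** Doubled, the eigenvector equation reads [(w s(x) - u x) eps_I = (w - u) x eps_I]; compare
    coordinates and cancel [w]. *)
Lemma hpi_eigenP (i h : 'I_n) x : lbl h = i ->
  hpi i *: e x = chi i (e x) <-> flip R (flip_idx I i h) x = x.
Proof.
move=> hi; split=> [E|E].
  have := hpi_cl_eps I hi x.
  rewrite [X in X + X]E -(cl_eps_tw i h) => /(can_inj eK)/addIr Ew.
  apply/esym/eqP; rewrite -subr_eq0; apply/eqP/(tw_w_reg (I := I) hi).
  by rewrite mulrBr Ew subrr.
apply: indM_addxx_inj; move: (hpi_cl_eps I hi x); rewrite E => ->.
exact: cl_eps_tw.
Qed.

Lemma gen_by_c_eigenP x :
  gen_by_c V x <-> forall i, hpi i *: e x = chi i (e x).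
Proof.
split=> [xV i|eig].
  have [i0|/ord_pred_lbl [h hi]] := eqVneq (i : nat) 0%N; last first.
    by apply/(hpi_eigenP _ hi)/(flip_id _ xV)/flip_idx_notin.
  have [iI|iI] := boolP (i \in I); last first.
    by rewrite /chi (negPf iI); apply: hpi_zero_notin.
  have [M0|[k ->]] := gen_by_c_scalar i0 iI xV.
    by rewrite [LHS]M0 [RHS]M0.
  rewrite cl_epsZ -[LHS]kscale_comm cl_eps1 [X in kscale _ X]hpi_eps /chi iI.
  exact: scalerN.
apply/gen_by_cP => j /notin_ValBC [jI|[i ji iI]]; last first.
  by have /(hpi_eigenP _ ji) := eig i; rewrite /flip_idx (negPf iI).
have [j0|/ord_pred_lbl [h hj]] := eqVneq (j : nat) 0%N; last first.
  by have /(hpi_eigenP _ hj) := eig j; rewrite /flip_idx jI.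
(* For [j = 0] in [I], [- x eps_I] is a scalar multiple of [eps_I], so [x] is a scalar and every
   sign change fixes it. *)
have [k] := hpi_zero_in x j0 jI; rewrite (eig j) /chi jI -cl_epsN.
move=> /(can_inj eK)/(canRL (@opprK _)) ->.
by rewrite -scaleNr flipZ flip1.
Qed.

(** For [i > 0] the sign change is multiplicative and fixes [c], so the formula for [2 pi_i y eps_I]
    can be multiplied by [c] on the right. *)
Lemma hpi_cl_epsMr i c y z : gen_by_c V c ->
  hpi i *: e y = e z -> hpi i *: e (y * c) = e (z * c).
Proof.
move=> cV E; have [i0|/ord_pred_lbl [h hi]] := eqVneq (i : nat) 0%N; last first.
  have sc : flip R (flip_idx I i h) c = c.
    exact/(flip_id _ cV)/flip_idx_notin.
  have := hpi_cl_eps I hi y; rewrite [X in X + X]E -cl_epsD.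
  move=> /(can_inj eK) Ez.
  apply: indM_addxx_inj; rewrite (hpi_cl_eps I hi) -cl_epsD -mulrDl Ez.
  by congr cl_eps; rewrite flipM sc [RHS]mulrBl; congr (_ - _); apply: mulrA.
have [iI|iI] := boolP (i \in I); last first.
  have -> : z = 0.
    by apply: (can_inj eK); rewrite cl_eps0 -E; apply: hpi_zero_notin.
  by rewrite mul0r cl_eps0; apply: hpi_zero_notin.
have [M0|[k ->]] := gen_by_c_scalar i0 iI cV.
  by rewrite [LHS]M0 [RHS]M0.
rewrite -[y * _]pres_scalerAr -[z * _]pres_scalerAr 2!mulr1 2!cl_epsZ -E.
exact/esym/kscale_comm.
Qed.

Lemma scaleZDl k (a b : HCl0B R n) (m : M) :
  (k *: a + b) *: m = kscale k (a *: m) + b *: m.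
Proof.
rewrite scalerDl; congr (_ + _).
by rewrite /kscale scalerA -[_ * a]pres_scalerAl mul1r.
Qed.

(** * The maps [f_c] and the isomorphism with the endomorphism algebra *)

Variables (f : Cl -> M -> M).
Hypothesis f_fc : is_fc f.

Lemma fcE c m : f c m = e (g m * c).
Proof. by rewrite -{1}[m]gK f_fc. Qed.

Lemma fcD c m m' : f c (m + m') = f c m + f c m'.
Proof.
rewrite -(gK m) -(gK m'); move: (g m) (g m') => x y.
rewrite -cl_epsD [LHS]f_fc [X in _ = X + _]f_fc [X in _ = _ + X]f_fc -cl_epsD.
by congr cl_eps; apply: mulrDl.
Qed.

Lemma fc_kscale c k m : f c (kscale k m) = kscale k (f c m).
Proof.
rewrite -(gK m); move: (g m) => x.
rewrite -cl_epsZ [LHS]f_fc [X in kscale _ X]f_fc -cl_epsZ; congr cl_eps.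
exact/esym/pres_scalerAl.
Qed.

(** Induction on [a]: [hpi_cl_epsMr] treats [pi_i], and associativity in [Cl_n] treats [c_j]. *)
Lemma fcZ c (a : HCl0B R n) m : gen_by_c V c -> f c (a *: m) = a *: f c m.
Proof.
move=> cV; elim/HCl_ind: a m => [m|k a b IHa IHb m|i a IHa m|j a IHa m].
- by rewrite 2!scale1r.
- rewrite [X in f c X]scaleZDl [RHS]scaleZDl fcD fc_kscale.
  by rewrite [X in kscale _ X]IHa [X in _ + X]IHb.
- rewrite -[in LHS]scalerA -[in RHS]scalerA -IHa; move: (a *: m) => {IHa}m.
  have E : hpi i *: e (g m) = e (g (hpi i *: m)) by rewrite 2!gK.
  by rewrite 2!fcE; apply/esym/hpi_cl_epsMr.
- rewrite -[in LHS]scalerA -[in RHS]scalerA -IHa; move: (a *: m) => {IHa}m.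
  rewrite -(gK m); move: (g m) => x.
  rewrite -cl_eps_clM [LHS]f_fc [X in _ *: X]f_fc -cl_eps_clM.
  by congr cl_eps; apply/esym/mulrA.
Qed.

Lemma fc_linear c : gen_by_c V c -> linear (f c).
Proof.
by move=> cV a m m'; rewrite fcD; congr (_ + _); apply: fcZ.
Qed.

(** The target is the opposite ring: multiplication in [endo] is composition, whereas [f_(cd)] is
    [f_c] followed by [f_d]. *)
Definition fc_endo (c : ClV R V) : (endo M)^c :=
  endo_of (fc_linear (asboolW (valP c))).

Lemma fc_endoE (c : ClV R V) m : (fc_endo c : endo M) m = f (val c) m.
Proof. by []. Qed.

Lemma fcDr c d m : f (c + d) m = f c m + f d m.
Proof. by rewrite 3!fcE mulrDr cl_epsD. Qed.

Lemma fcN c m : f (- c) m = - f c m.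
Proof. by rewrite 2!fcE mulrN cl_epsN. Qed.

Lemma fc1 m : f 1 m = m.
Proof. by rewrite fcE mulr1 gK. Qed.

Lemma fcM c d m : f (c * d) m = f d (f c m).
Proof. by rewrite 3!fcE eK mulrA. Qed.

Lemma fc_endo_zmod_morphism : zmod_morphism fc_endo.
Proof.
move=> c d; apply: endoP => m; rewrite [LHS]fc_endoE.
by rewrite [X in f X]raddfB fcDr fcN.
Qed.

Lemma fc_endo_monoid_morphism : monoid_morphism fc_endo.
Proof.
split=> [|c d]; apply: endoP => m; rewrite [LHS]fc_endoE.
  by rewrite [X in f X]rmorph1 fc1.
by rewrite [X in f X]rmorphM fcM.
Qed.

HB.instance Definition _ := GRing.isZmodMorphism.Build _ _ fc_endo
  fc_endo_zmod_morphism.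
HB.instance Definition _ := GRing.isMonoidMorphism.Build _ _ fc_endo
  fc_endo_monoid_morphism.

Lemma fc_endoZ k (c : ClV R V) : fc_endo (k *: c) = k *: (fc_endo c : endo M).
Proof.
apply: endoP => m; rewrite [LHS]fc_endoE.
by rewrite [X in f X]linearZ fcE -[_ * _]pres_scalerAr cl_epsZ -fcE.
Qed.

(** [F] commutes with each [pi_i], so [F(eps_I)] satisfies the eigenvector equations of [eps_I]. *)
Lemma endo_eps_gen (F : endo M) : in_ClV V (g (F (eps R I))).
Proof.
apply/asboolT/gen_by_c_eigenP => i; rewrite gK -endoZ hpi_eps /chi.
case: (i \in I); last exact: (raddf0 F).
exact: (raddfN F).
Qed.

Definition endo_eps (F : (endo M)^c) : ClV R V :=
  exist (in_ClV V) (g ((F : endo M) (eps R I))) (endo_eps_gen F).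

Lemma fc_endo_bij : bijective fc_endo.
Proof.
exists endo_eps => [c|F].
  by apply: val_inj; rewrite /= fcE eK -[X in g X]cl_eps1 eK mul1r.
apply: endoP => m; rewrite [LHS]fc_endoE /= -(gK m); move: (g m) => x.
(* Both sides are [x] applied to [F(eps_I)]. *)
by rewrite f_fc cl_epsM gK -endoZ.
Qed.

End EndInduced.

Theorem theorem5p4 (R : realType) (n : nat) (I : {set 'I_n}) :
  cl_free_on_eps R I ->
  let V := ValB (~: I) in
  (exists! f : Cl R n -> indM R I -> indM R I, is_fc f) /\
  forall f : Cl R n -> indM R I -> indM R I, is_fc f ->
  [/\ is_right_action (fun (m : indM R I) (c : ClV R V) => f (val c) m),
      forall (c : ClV R V) (a : HCl0B R n) (m : indM R I),
        f (val c) (a *: m) = a *: f (val c) m &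
      exists Phi : {rmorphism ClV R V -> (endo (indM R I))^c},
        [/\ forall (c : ClV R V) (m : indM R I),
              (Phi c : endo (indM R I)) m = f (val c) m,
            forall (k : R[i]) (c : ClV R V),
              Phi (k *: c) = k *: (Phi c : endo (indM R I)) &
            bijective Phi]].
Proof.
move=> [g eK gK] V; split.
  (* The coordinate [g] makes [f_c] well defined and forces its values. *)
  exists (fun c m => cl_eps I (g m * c)); split=> [c x|f f_fc].
    by rewrite eK.
  by apply/funext => c; apply/funext => m; rewrite (fcE gK f_fc).
move=> f f_fc; split.
- split=> [m|m c d|m m' c|m c d].
  + exact: (fc1 gK f_fc).
  + exact: (fcM eK gK f_fc).
  + exact: (fcD gK f_fc).
  + exact: (fcDr gK f_fc).
- by move=> c a m; apply: (fcZ eK gK f_fc); apply: asboolW (valP c).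
- exists (fc_endo eK gK f_fc); split.
  + by move=> c m; apply: fc_endoE.
  + by move=> k c; apply: fc_endoZ.
  + exact: fc_endo_bij.
Qed.
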